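(* \textsc{Upper Clique Transversal} can be solved in linear time in the class of split graphs. That is, there is an algorithm that, given a split graph $G=(V,E)$ and an integer $k$, decides in time $\mathcal{O}(|V|+|E|)$ whether $G$ contains a minimal clique transversal $S$ with $|S|\ge k$.
   Context: All graphs are finite, simple, and undirected. A clique is a set of pairwise adjacent vertices; it is maximal if it is not properly contained in another clique. A clique transversal in $G$ is a set $S\subseteq V(G)$ that intersects every maximal clique of $G$; it is minimal if it does not contain any other clique transversal. \textsc{Upper Clique Transversal} is the decision problem: given a graph $G$ and an integer $k$, does $G$ contain a minimal clique transversal $S$ such that $|S|\ge k$? A split graph is a graph whose vertex set can be partitioned into a clique and an independent set (a set of pairwise non-adjacent vertices). Linear time means time linear in the number of vertices plus the number of edges. *)

(* Defs.v *)
From mathcomp Require Import all_boot all_order all_algebra.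

Set Implicit Arguments.
Unset Strict Implicit.
Unset Printing Implicit Defensive.

Import Order.TTheory GRing.Theory Num.Theory.
Local Open Scope ring_scope.

Section Graphs.

Variables (T : finType) (e : rel T).

Definition simple_graph : Prop := symmetric e /\ irreflexive e.

Definition edges : {set {set T}} :=
  [set [set p.1; p.2] | p : T * T & e p.1 p.2].

Definition clique (K : {set T}) : bool :=
  [forall x in K, forall y in K, (x != y) ==> e x y].

Definition independent (I : {set T}) : bool :=
  [forall x in I, forall y in I, (x != y) ==> ~~ e x y].

Definition split_graph : bool :=
  [exists K : {set T}, clique K && independent (~: K)].

Definition maximal_clique (K : {set T}) : bool := maxset clique K.

Definition clique_transversal (S : {set T}) : bool :=
  [forall K : {set T}, maximal_clique K ==> (S :&: K != set0)].

Definition minimal_clique_transversal (S : {set T}) : bool :=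
  minset clique_transversal S.

Definition upper_clique_transversal (k : int) : bool :=
  [exists S : {set T}, minimal_clique_transversal S && (k <= #|S|%:Z)].

(* The order inside each list is arbitrary. *)
Definition adjacency_lists (adj : T -> seq T) : Prop :=
  forall v, perm_eq (adj v) (enum (e v)).

End Graphs.

(* A unit-cost random access machine in the style of Cook and Reckhow, with   *)
(* integer registers, addition and subtraction but no multiplication, and a   *)
(* word-addressed memory accessible only through Fetch and Store. A program   *)
(* mentions finitely many registers, by fixed indices.                        *)
Inductive instr :=
  | Const of nat & int        (* r_i := z *)
  | Plus of nat & nat & nat   (* r_i := r_j + r_l *)
  | Minus of nat & nat & nat  (* r_i := r_j - r_l *)
  | Fetch of nat & nat        (* r_i := mem[r_j] *)
  | Store of nat & nat        (* mem[r_i] := r_j *)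
  | JumpPos of nat & nat      (* if r_i > 0 then jump to instruction p *)
  | Accept
  | Reject.

Definition program := seq instr.

(* [run P W t pc r m] executes P from program counter pc, registers r and     *)
(* memory m, and is [Some b] iff the machine halts with answer b after at     *)
(* most t instructions, the final Accept or Reject included. It is [None] on  *)
(* running out of time and also on a fault: a program counter out of range,   *)
(* a negative address, or a value of absolute value greater than the word     *)
(* bound W.                                                                   *)
Fixpoint run (P : program) (W t pc : nat) (r m : nat -> int) : option bool :=
  if t isn't t'.+1 then None else
  let set_reg i z :=
    if (`|z| <= W)%N then run P W t' pc.+1 [eta r with i |-> z] m else None in
  match onth P pc with
  | Some (Const i z) => set_reg i z
  | Some (Plus i j l) => set_reg i (r j + r l)
  | Some (Minus i j l) => set_reg i (r j - r l)
  | Some (Fetch i j) => if r j is Posz a then set_reg i (m a) else None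
  | Some (Store i j) =>
      if r i is Posz a then run P W t' pc.+1 r [eta m with a |-> r j] else None
  | Some (JumpPos i p) => run P W t' (if 0 < r i then p else pc.+1) r m
  | Some Accept => Some true
  | Some Reject => Some false
  | None => None
  end.

(* The words k, n, then for v = 0, ..., n-1 the length of the adjacency list  *)
(* of v followed by its entries.                                              *)
Definition encode (n : nat) (adj : 'I_n -> seq 'I_n) (k : int) : seq int :=
  [:: k, n%:Z &
     flatten [seq (size (adj v))%:Z :: [seq (val w)%:Z | w <- adj v]
             | v <- enum 'I_n]].

(* Registers, and memory cells past the input, are initially 0. *)
Definition run_on (P : program) (W t : nat) (input : seq int) : option bool :=
  run P W t 0 (fun=> 0) (nth 0 input).

(* Main.v *)
(* A split graph has a maximal clique K whose complement is independent. The  *)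
(* maximal cliques are then K and the closed neighborhoods of the vertices    *)
(* outside K. For b in K, the non-neighbors of b form a minimal clique        *)
(* transversal, of size n - deg b.                                            *)
(* Conversely, a minimal clique transversal S contains some b in K, and each  *)
(* neighbor of b in S is the only vertex of S in the closed neighborhood of   *)
(* some u outside of K and S and not adjacent to b; this gives                *)
(* deg b <= n - |S|. So the question is whether deg b + k <= n for some b in  *)
(* K. As the vertices outside K have degrees below |K| and those in K have    *)
(* degrees at least |K| - 1, this amounts to j < |K|, where j is the number   *)
(* of vertices with degree at least n - k + 1, and j < |K| iff more than j    *)
(* vertices have degree at least j. Two passes over the input that count the  *)
(* adjacency lists of at least some given length thus suffice.                *)

Require Import Defs.
From mathcomp Require Import all_boot all_order all_algebra zify.

Set Implicit Arguments.
Unset Strict Implicit.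
Unset Printing Implicit Defensive.

Import Order.TTheory GRing.Theory Num.Theory.

(** Fix a maximal clique K with independent complement. The non-neighbors of any b in K form a
    minimal transversal ([nonneighbors_minimal_transversal]), and no minimal transversal containing
    b is larger ([minimal_transversal_nbhd_card]), so the answer depends on the least degree in K.
    [exists_clique_degree] and [clique_size_gt] then eliminate K: two threshold counts on the degree
    sequence decide, and no split partition has to be computed. Degrees are the stored list lengths,
    and the machine jumps from one length to the next, so it makes O(n) steps; the edge count bounds
    the addresses, through [sum_degrees_le]. *)

Section SplitGraphs.

Variables (T : finType) (e : rel T).
Hypotheses (e_sym : symmetric e) (e_irr : irreflexive e).
Implicit Types K M S : {set T}.

(** * Cliques, split partitions, private cliques of a transversal *)

Lemma cliqueP K :
  reflect {in K &, forall x y, x != y -> e x y} (clique e K).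
Proof.
apply: (iffP forall_inP) => [cK x y xK yK | cK x xK].
  by move/implyP: (forall_inP (cK x xK) y yK).
by apply/forall_inP => y yK; apply/implyP; apply: cK.
Qed.

Lemma independentP K :
  reflect {in K &, forall x y, ~~ e x y} (independent e K).
Proof.
apply: (iffP forall_inP) => [iK x y xK yK | iK x xK].
  have [->|xy] := eqVneq x y; first by rewrite e_irr.
  by move/implyP: (forall_inP (iK x xK) y yK); apply.
by apply/forall_inP => y yK; apply/implyP => _; apply: iK.
Qed.

Lemma maximal_clique_ext M x :
  maximal_clique e M -> {in M, forall y, x != y -> e x y} -> x \in M.
Proof.
move=> /maxsetP[/cliqueP cM maxM] xM.
rewrite -[M](maxM (x |: M)) ?setU11 ?subsetU1 //.
apply/cliqueP => y z; rewrite !inE.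
move=> /predU1P[->|yM] /predU1P[->|zM]; rewrite ?eqxx //.
- exact: xM.
- by rewrite eq_sym e_sym; apply: xM.
- exact: cM.
Qed.

Lemma split_maximal_clique :
  split_graph e -> exists2 K, maximal_clique e K & independent e (~: K).
Proof.
move=> /existsP[K0 splitK0].
have [K /maxsetP[/andP[cK iK] maxK] _] :=
  @maxset_exists T (fun K => clique e K && independent e (~: K)) K0 splitK0.
(* Enlarging K shrinks its complement, which stays independent, so K is maximal among all
   cliques. *)
exists K => //; apply/maxsetP; split=> // M cM KM; apply: maxK => //.
rewrite cM; apply/independentP => x y; rewrite -setCS in KM.
by move=> /(subsetP KM) xK /(subsetP KM) yK; apply: (independentP _ iK).
Qed.

(** Deleting x from S leaves some maximal clique unmet, although S meets it. *)
Lemma minimal_transversal_private S x :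
  minimal_clique_transversal e S -> x \in S ->
  exists2 M, maximal_clique e M & S :&: M = [set x].
Proof.
move=> /minsetP[/forallP trS minS] xS.
have: ~~ clique_transversal e (S :\ x).
  apply/negP => tr; have := minS _ tr (subD1set _ _).
  by move=> SE; move: xS; rewrite -SE !inE eqxx.
rewrite negb_forall => /existsP[M]; rewrite negb_imply negbK => /andP[maxM].
rewrite setIDAC => /eqP SM0; exists M => //.
have /set0Pn[y ySM] := implyP (trS M) maxM.
apply/eqP; rewrite eqEsubset -setD_eq0 SM0 eqxx sub1set.
have [<-//|yx] := eqVneq y x.
by move/setP/(_ y): SM0; rewrite !inE yx; move: ySM; rewrite inE => ->.
Qed.

(** * Transversals and degrees relative to a split partition *)

Section Partition.

Variable K : {set T}.
Hypotheses (maxK : maximal_clique e K) (indK : independent e (~: K)).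

Let cK : {in K &, forall x y, x != y -> e x y}.
Proof. by apply/cliqueP; case/maxsetP: maxK. Qed.

Lemma independent_neighbor u v : u \notin K -> e u v -> v \in K.
Proof.
move=> uK uv; apply: contraLR uv => vK.
by apply: (independentP _ indK); rewrite inE.
Qed.

Lemma independent_nbhd_maximal u :
  u \notin K -> maximal_clique e (u |: [set v | e u v]).
Proof.
move=> uK; have nK v := @independent_neighbor u v uK.
apply/maxsetP; split.
  apply/cliqueP => y z; rewrite !inE.
  move=> /predU1P[->|uy] /predU1P[->|uz]; rewrite ?eqxx //.
  - by rewrite e_sym.
  - by apply: cK; apply: nK.
move=> M /cliqueP cM uM; apply/eqP; rewrite eqEsubset uM andbT.
apply/subsetP => v vM; rewrite !inE; have [//|vu] := eqVneq v u.
by rewrite cM 1?eq_sym //; apply: (subsetP uM); rewrite setU11.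
Qed.

Lemma independent_maximal_clique u M :
  u \notin K -> u \in M -> maximal_clique e M -> M = u |: [set v | e u v].
Proof.
move=> uK uM /maxsetP[/cliqueP cM maxM]; apply/esym/maxM.
  by case/maxsetP: (independent_nbhd_maximal uK).
apply/subsetP => v vM; rewrite !inE; have [//|vu] := eqVneq v u.
by rewrite cM // eq_sym.
Qed.

Lemma nonneighbors_minimal_transversal b :
  b \in K -> minimal_clique_transversal e [set v | ~~ e b v].
Proof.
move=> bK; apply/minsetP; split.
  apply/forallP => M; apply/implyP => maxM; apply/set0Pn.
  case: (boolP [forall y in M, e b y]) => [/forall_inP bM|].
    by exists b; rewrite !inE e_irr (maximal_clique_ext maxM) // => y /bM.
  rewrite negb_forall_in => /exists_inP[y yM bNy].
  by exists y; rewrite !inE bNy.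
move=> S /forallP trS sS; apply/eqP; rewrite eqEsubset sS.
apply/subsetP => s; rewrite inE => bs.
have priv M :
    maximal_clique e M -> {in M, forall y, y != s -> e b y} -> s \in S.
  move=> maxM sM; have /set0Pn[y] := implyP (trS M) maxM.
  rewrite inE => /andP[yS yM]; have [<-//|ys] := eqVneq y s.
  by have := subsetP sS _ yS; rewrite inE sM.
(* The clique private to b is K; any other non-neighbor s lies outside K, and its closed
   neighborhood is private to it. *)
have [sb|sb] := eqVneq s b.
  apply: (priv K) => // y yK ys; apply: cK => //.
  by rewrite -sb eq_sym.
have sK : s \notin K by apply: contra bs => sK; apply: cK; rewrite // eq_sym.
apply: (priv _ (independent_nbhd_maximal sK)) => y.
rewrite !inE => /predU1P[->|sy _]; first by rewrite eqxx.
apply: cK => //; first exact: (independent_neighbor sK sy).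
by apply: contra bs => /eqP ->; rewrite e_sym.
Qed.

(** The map [f] from the complement of S covers the neighbors of b: those outside S are fixed, and x
    in S is the image of a vertex u of its private clique that is not adjacent to b. *)
Lemma minimal_transversal_nbhd_card S b :
  minimal_clique_transversal e S -> b \in S -> b \in K ->
  #|e b| <= #|~: S|.
Proof.
move=> minS bS bK.
pose f u := if e b u then u else odflt u [pick x in S | e u x].
apply: leq_trans (leq_imset_card f _); apply/subset_leq_card/subsetP => x bx.
have {}bx : e b x by [].
have [xS|xS] := boolP (x \in S); last first.
  by apply/imsetP; exists x; rewrite ?inE // /f bx.
have [M maxM SM] := minimal_transversal_private minS xS.
have inSM y : y \in S -> y \in M -> y = x.
  by move=> yS yM; apply/set1P; rewrite -SM inE yS.
have xM : x \in M by have := set11 x; rewrite -SM inE => /andP[].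
have bM : b \notin M.
  by apply/negP => bM; move: bx; rewrite -(inSM b) // e_irr.
have /exists_inP[u uM /andP[bu bNu]] : [exists u in M, (b != u) && ~~ e b u].
  apply: contraR bM; rewrite negb_exists_in => /forall_inP bM.
  apply: (maximal_clique_ext maxM) => y /bM.
  by rewrite negb_and !negbK => /orP[/eqP->|->//]; rewrite eqxx.
have uS : u \notin S.
  by apply: contra bNu => uS; rewrite (inSM u).
have uK : u \notin K by apply: contra bNu => uK; apply: cK.
(* M is the closed neighborhood of u, so x is the only neighbor of u in S and [pick] must return
   it. *)
have ME := independent_maximal_clique uK uM maxM.
apply/imsetP; exists u; rewrite ?inE // /f (negbTE bNu).
case: pickP => [y /andP[yS uy]|/(_ x)] /=.
  by rewrite (inSM y) // ME !inE uy orbT.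
move: xM; rewrite xS ME !inE => /predU1P[xu|->//].
by move: uS; rewrite -xu xS.
Qed.

Lemma upper_clique_transversal_degree (k : int) :
  upper_clique_transversal e k =
    [exists b in K, (#|e b|%:Z + k <= #|T|%:Z)%R].
Proof.
apply/existsP/exists_inP => [[S /andP[minS kS]]|[b bK kb]].
  have /minsetP[/forallP/(_ K)/implyP/(_ maxK)/set0Pn[b]] := minS.
  rewrite inE => /andP[bS bK] _; exists b => //.
  have := minimal_transversal_nbhd_card minS bS bK; have := cardsC S; lia.
exists [set v | ~~ e b v]; rewrite nonneighbors_minimal_transversal //=.
have := cardsC [set v | e b v]; rewrite cardsE.
have -> : ~: [set v | e b v] = [set v | ~~ e b v].
  by apply/setP=> v; rewrite !inE.
lia.
Qed.

Lemma clique_degree b : b \in K -> #|K| <= #|e b|.+1.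
Proof.
move=> bK; rewrite (cardsD1 b K) bK; apply/subset_leq_card/subsetP => v.
by rewrite !inE => /andP[vb vK]; apply: cK; rewrite // eq_sym.
Qed.

(** All neighbors of u lie in K, and maximality of K makes the inclusion strict. *)
Lemma independent_degree u : u \notin K -> #|e u| < #|K|.
Proof.
move=> uK; apply: proper_card; apply/properP; split.
  by apply/subsetP => v; apply: independent_neighbor.
apply/exists_inP; apply: contraR uK; rewrite negb_exists_in => /forall_inP uK.
by apply: (maximal_clique_ext maxK) => y /uK; rewrite negbK.
Qed.

Lemma clique_size_gt (j : nat) :
  (j < #|K|) = (j < #|[pred v | j <= #|e v|]|).
Proof.
apply/idP/idP => [jK|].
  apply: leq_trans (jK) (subset_leq_card _); apply/subsetP => v vK.
  by have := clique_degree vK; rewrite !inE; lia.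
apply: contraLR; rewrite -!leqNgt => Kj; apply: leq_trans (Kj).
apply/subset_leq_card/subsetP => v; rewrite !inE; apply: contraLR => vK.
by have := independent_degree vK; lia.
Qed.

Lemma exists_clique_degree (k : int) :
  [exists b in K, (#|e b|%:Z + k <= #|T|%:Z)%R] =
    (#|[pred v | (#|T|%:Z - k + 1 <= #|e v|%:Z)%R]| < #|K|).
Proof.
apply/idP/idP => [/exists_inP[b bK kb]|].
  rewrite (cardsD1 b K) bK ltnS; apply/subset_leq_card/subsetP => v.
  rewrite !inE => kv; have [vb|_] := eqVneq v b.
    by move: kv; rewrite vb; lia.
  apply: contraLR kv => vK.
  have := independent_degree vK; have := clique_degree bK; lia.
apply: contraTT; rewrite negb_exists_in -leqNgt => /forall_inP Kk.
by apply/subset_leq_card/subsetP => b /Kk; rewrite !inE; lia.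
Qed.

End Partition.

Lemma split_upper_clique_transversal (k : int)
    (j := #|[pred v | (#|T|%:Z - k + 1 <= #|e v|%:Z)%R]|) :
  split_graph e ->
  upper_clique_transversal e k = (j < #|[pred v | j <= #|e v|]|).
Proof.
move=> /split_maximal_clique[K maxK indK].
rewrite (upper_clique_transversal_degree maxK indK).
by rewrite (exists_clique_degree maxK indK) (clique_size_gt maxK indK).
Qed.

(** Ordered adjacent pairs are grouped by their underlying edge, at most two per edge. *)
Lemma sum_degrees_le : \sum_v #|e v| <= 2 * #|edges e|.
Proof.
pose D := [set p : T * T | e p.1 p.2].
pose h (p : T * T) := [set p.1; p.2].
have -> : \sum_v #|e v| = \sum_(p in D) 1.
  rewrite (eq_bigr (fun v => \sum_(w | e v w) 1)) => [|v _].
    by rewrite pair_big_dep; apply: eq_bigl => p; rewrite inE.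
  by rewrite -sum1_card; apply: eq_bigl.
have -> : edges e = h @: D.
  by apply/setP => E; apply/imsetP/imsetP => -[p pD ->]; exists p;
    move: pD; rewrite ?inE.
rewrite (partition_big_imset h) /= mulnC -sum_nat_const leq_sum // => E.
case/imsetP => -[x y] _ -> /=; rewrite /h /=.
apply: (@leq_trans #|[set (x, y); (y, x)]|); last first.
  by rewrite cards2; case: (_ != _).
rewrite sum1_card; apply/subset_leq_card/subsetP => -[z w] /andP[].
rewrite !inE /= => zw /eqP/setP zwE.
have zNw : z != w by apply: contraTneq zw => ->; rewrite e_irr.
move: (zwE z) (zwE w) zNw; rewrite !inE !eqxx orbT !xpair_eqE /=.
by move=> /esym/orP[]/eqP-> /esym/orP[]/eqP->; rewrite ?eqxx ?orbT.
Qed.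

End SplitGraphs.

(** * Execution of the counting program *)

Section Machine.

Local Open Scope ring_scope.

Lemma run_mono P W t t' pc r m b :
  (t <= t')%N -> run P W t pc r m = Some b -> run P W t' pc r m = Some b.
Proof.
elim: t t' pc r m => [|t IH] [|t'] //= pc r m tt'.
case: (onth P pc) => [[i z|i j l|i j l|i j|i j|i p||]|] //;
  do ?[by case: ifP => // _; apply: IH | by apply: IH].
- by case: (r j) => // a; case: ifP => // _; apply: IH.
- by case: (r i) => // a; apply: IH.
Qed.

Section Steps.

Variables (P : program) (W t pc : nat) (r m : nat -> int).

Lemma run_const i z :
  onth P pc = Some (Const i z) -> (`|z| <= W)%N ->
  run P W t.+1 pc r m = run P W t pc.+1 [eta r with i |-> z] m.
Proof. by move=> /= -> ->. Qed.

Lemma run_plus i j l z :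
  onth P pc = Some (Plus i j l) -> r j + r l = z -> (`|z| <= W)%N ->
  run P W t.+1 pc r m = run P W t pc.+1 [eta r with i |-> z] m.
Proof. by move=> /= -> -> ->. Qed.

Lemma run_minus i j l z :
  onth P pc = Some (Minus i j l) -> r j - r l = z -> (`|z| <= W)%N ->
  run P W t.+1 pc r m = run P W t pc.+1 [eta r with i |-> z] m.
Proof. by move=> /= -> -> ->. Qed.

Lemma run_fetch i j a z :
  onth P pc = Some (Fetch i j) -> r j = Posz a -> m a = z -> (`|z| <= W)%N ->
  run P W t.+1 pc r m = run P W t pc.+1 [eta r with i |-> z] m.
Proof. by move=> /= -> -> -> ->. Qed.

Lemma run_jump i p x :
  onth P pc = Some (JumpPos i p) -> r i = x ->
  run P W t.+1 pc r m = run P W t (if 0 < x then p else pc.+1) r m.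
Proof. by move=> /= -> ->. Qed.

End Steps.

Local Arguments run : simpl never.

(* Placed at position [p]: adds to r_4 the number of lists of length at least *)
(* r_3 among the r_2 consecutive lists stored from address r_1 on. Register 0 *)
(* must contain 1.                                                            *)
Definition count_loop (p : nat) : program :=
  [:: JumpPos 0 (p + 8);
      Fetch 5 1;
      Plus 1 1 5;
      Plus 1 1 0;
      Minus 2 2 0;
      Minus 5 3 5;
      JumpPos 5 (p + 8);
      Plus 4 4 0;
      JumpPos 2 (p + 1)].

(** [Fetch 3 4] reads k at address 0 because r_4 is still 0. [Plus 3 4 2] copies the first count to
    r_3 because a finished pass leaves r_2 = 0. *)
Definition uct_program : program :=
  [:: Const 0 1;
      Const 1 2;
      Fetch 2 0;
      Fetch 3 4;
      Minus 3 2 3;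
      Plus 3 3 0] ++
  count_loop 6 ++
  [:: Plus 3 4 2;
      Const 4 0;
      Const 1 2;
      Fetch 2 0] ++
  count_loop 19 ++
  [:: Minus 4 4 3;
      JumpPos 4 31;
      Reject;
      Accept].

Definition blocks (ls : seq (seq int)) : seq int :=
  flatten [seq (size l)%:Z :: l | l <- ls].

Lemma size_blocks ls : size (blocks ls) = (size ls + sumn (map size ls))%N.
Proof.
by elim: ls => //= l ls; rewrite /blocks /= size_cat => ->; lia.
Qed.

(** The induction starts at the loop test, at offset 8, with the count c so far generalized. What
    follows the loop enters as a continuation, which keeps only the registers needed later. *)
Lemma run_count_loop_test P W p (m : nat -> int) t b (theta : int) ls a c
    (r : nat -> int) :
  (forall i, (i < 9)%N -> onth P (p + i) = onth (count_loop p) i) ->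
  r 0%N = 1 -> r 1%N = a%:Z -> r 2%N = (size ls)%:Z -> r 3%N = theta ->
  r 4%N = c%:Z ->
  (forall i, m (a + i)%N = nth 0 (blocks ls) i) ->
  (a + size (blocks ls) <= W)%N -> (`|theta| + size (blocks ls) <= W)%N ->
  (c + size ls <= W)%N ->
  (forall r' : nat -> int, r' 0%N = 1 -> r' 2%N = 0 -> r' 3%N = theta ->
     r' 4%N = (c + count (fun l : seq int => theta <= (size l)%:Z)%R ls)%N%:Z ->
     run P W t (p + 9) r' m = Some b) ->
  run P W (8 * size ls + 1 + t) (p + 8) r m = Some b.
Proof.
move=> code; elim: ls a c r => [|l ls IH] a c r r0 r1 r2 r3 r4 mE aW tW cW post.
  by rewrite (run_jump _ _ _ (code 8 _) r2) //= -addnS; apply: post;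
    rewrite // addn0.
have mE0 := mE 0%N; rewrite addn0 /= in mE0.
have -> : (8 * size (l :: ls) + 1 + t)%N = (8 * size ls + 1 + t).+4.+4.
  by rewrite /=; lia.
rewrite /= size_cat -?/(blocks ls) in aW tW cW; rewrite /= in r2.
rewrite (run_jump _ _ _ (code 8 _) r2) //=.
rewrite (run_fetch _ (code 1 _) r1 mE0) //= -?(addnS p); last lia.
rewrite (@run_plus _ _ _ _ _ _ 1 1 5 (a + size l)%N%:Z) ?code //=
  -?(addnS p); [|lia|lia].
rewrite (@run_plus _ _ _ _ _ _ 1 1 0 (a + size l).+1%N%:Z) ?code //=
  -?(addnS p); [|lia|lia].
rewrite (@run_minus _ _ _ _ _ _ 2 2 0 (size ls)%:Z) ?code //=
  -?(addnS p); [|lia|lia].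
rewrite (@run_minus _ _ _ _ _ _ 5 3 5 (theta - (size l)%:Z)) ?code //=
  -?(addnS p); [|by rewrite r3|lia].
rewrite (run_jump _ _ _ (code 6 _) erefl) //= subr_gt0.
have mE' i : m ((a + size l).+1 + i)%N = nth 0 (blocks ls) i.
  have := mE (size l + i).+1; rewrite /= nth_cat ltnNge leq_addr /= addKn => <-.
  by congr m; lia.
case: ltP => [l_lt | l_ge] /=.
  (* A short list skips the increment, saving one of the eight steps. *)
  apply: (@run_mono _ _ (8 * size ls + 1 + t)); first lia.
  apply: (IH (a + size l).+1 c) => //=; [lia|lia|lia|].
  by move=> r' h0 h2 h3 h4; apply: post; rewrite //= leNgt l_lt.
rewrite -(addnS p) (@run_plus _ _ _ _ _ _ 4 4 0 c.+1%:Z) ?code //=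
  -?(addnS p); [|lia|lia].
apply: (IH (a + size l).+1 c.+1) => //=; [lia|lia|lia|].
by move=> r' h0 h2 h3 h4; apply: post; rewrite //= l_ge addnA addn1.
Qed.

Lemma run_count_loop P W p (m : nat -> int) t b (theta : int) ls a
    (r : nat -> int) :
  (forall i, (i < 9)%N -> onth P (p + i) = onth (count_loop p) i) ->
  r 0%N = 1 -> r 1%N = a%:Z -> r 2%N = (size ls)%:Z -> r 3%N = theta ->
  r 4%N = 0 ->
  (forall i, m (a + i)%N = nth 0 (blocks ls) i) ->
  (a + size (blocks ls) <= W)%N -> (`|theta| + size (blocks ls) <= W)%N ->
  (forall r' : nat -> int, r' 0%N = 1 -> r' 2%N = 0 -> r' 3%N = theta ->
     r' 4%N = (count (fun l : seq int => theta <= (size l)%:Z)%R ls)%:Z ->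
     run P W t (p + 9) r' m = Some b) ->
  run P W (8 * size ls + 2 + t) p r m = Some b.
Proof.
move=> code r0 r1 r2 r3 r4 mE aW tW post.
have -> : (8 * size ls + 2 + t)%N = (8 * size ls + 1 + t).+1 by lia.
have := code 0%N isT; rewrite addn0 => code0.
rewrite (run_jump _ _ _ code0 r0) ltr01.
apply: (run_count_loop_test (a := a) (c := 0) (theta := theta)) => //.
by rewrite size_blocks in aW; lia.
Qed.

Lemma run_uct_program W ls (k : int) t
    (j := count (fun l : seq int => (size ls)%:Z - k + 1 <= (size l)%:Z) ls) :
  (2 + size (blocks ls) + size ls + `|k| <= W)%N ->
  (16 * size ls + 20 <= t)%N ->
  run_on uct_program W t [:: k, (size ls)%:Z & blocks ls] =
    Some (j < count (fun l : seq int => (j <= size l)%N) ls)%N.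
Proof.
rewrite /run_on => leW lt; apply: run_mono lt _.
have j_le : (j <= size ls)%N := count_size _ _.
set m := nth 0 _; set P := uct_program.
(* Six setup steps, a pass, four steps of reset, a second pass, and six steps that suffice for the
   final comparison. *)
have -> : (16 * size ls + 20)%N =
    (8 * size ls + 2 + (8 * size ls + 2 + 6).+4).+4.+2 by lia.
have mE i : m (2 + i)%N = nth 0 (blocks ls) i by [].
rewrite (@run_const _ _ _ _ _ _ 0 1) //=; last lia.
rewrite (@run_const _ _ _ _ _ _ 1 2) //=; last lia.
rewrite (@run_fetch _ _ _ _ _ _ 2 0 1 (size ls)%:Z) //=; last lia.
rewrite (@run_fetch _ _ _ _ _ _ 3 4 0 k) //=; last lia.
rewrite (@run_minus _ _ _ _ _ _ 3 2 3 ((size ls)%:Z - k)) //=; last lia.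
rewrite (@run_plus _ _ _ _ _ _ 3 3 0 ((size ls)%:Z - k + 1)) //=; last lia.
apply: (run_count_loop (p := 6) (theta := (size ls)%:Z - k + 1) _
  erefl erefl erefl erefl erefl mE); [|lia|lia|].
  by do 9?case.
move=> r r0 r2 r3 r4; rewrite -/j in r4.
rewrite (@run_plus _ _ _ _ _ _ 3 4 2 j) ?r4 ?r2 ?addr0 //=; last lia.
rewrite (@run_const _ _ _ _ _ _ 4 0) //=.
rewrite (@run_const _ _ _ _ _ _ 1 2) //=; last lia.
rewrite (@run_fetch _ _ _ _ _ _ 2 0 1 (size ls)%:Z) //=; last lia.
apply: (run_count_loop (p := 19) (theta := j) _ _
  erefl erefl erefl erefl mE) => //; [|lia|lia|].
  by do 9?case.
move=> {r0 r2 r3 r4}r r0 r2 r3 r4; set j' := count _ _ in r4 *.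
rewrite (@run_minus _ _ _ _ _ _ 4 4 3 (j'%:Z - j%:Z)) ?r4 ?r3 //=; last first.
  have : (j' <= size ls)%N := count_size _ _; lia.
rewrite (run_jump _ _ _ (_ : _ = Some (JumpPos 4 31)) erefl) //=.
rewrite subr_gt0 ltz_nat.
by case: ltnP.
Qed.

Lemma encode_blocks n (adj : 'I_n -> seq 'I_n) k
    (ls := [seq [seq (val w)%:Z | w <- adj v] | v <- enum 'I_n]) :
  encode adj k = [:: k, (size ls)%:Z & blocks ls].
Proof.
rewrite /encode /blocks /ls size_map size_enum_ord -[in RHS]map_comp.
by congr [:: _, _ & flatten _]; apply: eq_map => v /=; rewrite size_map.
Qed.

End Machine.

Theorem corollary4p3 :
  exists (P : program) (c : nat),
    forall (n : nat) (e : rel 'I_n) (adj : 'I_n -> seq 'I_n) (k : int),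
      simple_graph e -> split_graph e -> adjacency_lists e adj ->
      run_on P (c * (n + #|edges e| + `|k|%N + 1)%N)%N
               (c * (n + #|edges e| + 1))%N (encode adj k)
        = Some (upper_clique_transversal e k).
Proof.
(* 20 covers the 16n + 20 steps, and also the word bound 2 + 2n + 2|E| + |k|. *)
exists uct_program, 20 => n e adj k [e_sym e_irr] split_e adjE.
have size_adj v : size (adj v) = #|e v| by rewrite (perm_size (adjE v)) cardE.
rewrite encode_blocks; set ls := map _ _.
have size_ls : size ls = n by rewrite size_map size_enum_ord.
have count_ls (a : pred nat) :
    count (fun l : seq int => a (size l)) ls = #|[pred v | a #|e v|]|.
  rewrite count_map enumT cardE size_filter; apply: eq_count => v.
  by rewrite /= size_map size_adj.
have sum_ls : sumn (map size ls) <= 2 * #|edges e|.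
  rewrite -map_comp sumnE big_map big_enum /=.
  under eq_bigr do rewrite size_map size_adj.
  exact: sum_degrees_le.
rewrite run_uct_program ?size_blocks ?size_ls; [|lia|lia].
rewrite split_upper_clique_transversal // card_ord.
by rewrite (count_ls (fun d => (n%:Z - k + 1 <= d%:Z)%R)) (count_ls (leq _)).
Qed.
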